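(* Let $\mathcal{C}$ be a clutter with the König property and without isolated vertices. Then $\mathcal{C}$ is unmixed if and only if there is a perfect matching $e_1,\ldots,e_g$ of $\mathcal{C}$ of König type such that for any two edges $e\neq e'$ of $\mathcal{C}$ and for any two distinct vertices $x\in e$, $y\in e'$ both contained in some $e_i$, one has that $(e\setminus\{x\})\cup(e'\setminus\{y\})$ contains an edge of $\mathcal{C}$.
   Context: A clutter $\mathcal{C}$ with finite vertex set $X=\{x_1,\ldots,x_n\}$ is a family $E(\mathcal{C})$ of subsets of $X$, called edges, none of which is included in another. A vertex is isolated if it occurs in no edge. The edge ideal $I(\mathcal{C})$ is the ideal of the polynomial ring $R=K[x_1,\ldots,x_n]$ over a field $K$ generated by the monomials $\prod_{x_i\in e}x_i$, $e\in E(\mathcal{C})$. A vertex cover of $\mathcal{C}$ is a subset of $X$ meeting every edge; it is minimal if no proper subset is a vertex cover. The height of $I(\mathcal{C})$ equals the minimum size of a vertex cover (the covering number). $\mathcal{C}$ is unmixed if all its minimal vertex covers have the same size. $\mathcal{C}$ has the König property if the maximum number of pairwise disjoint edges of $\mathcal{C}$ equals the height of $I(\mathcal{C})$. A perfect matching of König type of $\mathcal{C}$ is a collection $e_1,\ldots,e_g$ of pairwise disjoint edges whose union is $X$ and such that $g$ is the height of $I(\mathcal{C})$. *)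

(* Defs.v *)
From HB Require Import structures.
From mathcomp Require Import all_boot all_order all_algebra.
From mathcomp.multinomials Require Import mpoly.

Set Implicit Arguments.
Unset Strict Implicit.
Unset Printing Implicit Defensive.

Import GRing.Theory.

Local Open Scope ring_scope.

(* Height of an ideal of a commutative ring.  Primes are the library's boolean
   ones ([prime_idealr], hence proper); arbitrary ideals, such as those given by
   generators, are Prop predicates. *)
Section Height.
Variable R : comNzRingType.

(* c 0 < c 1 < ... < c m = P; the values of c beyond m are irrelevant. *)
Definition prime_chain (P : prime_idealr R) (m : nat) : Prop :=
  exists c : nat -> prime_idealr R,
    (forall i, (i < m)%N ->
       {subset c i <= c i.+1} /\ ~ {subset c i.+1 <= c i})
    /\ c m =i P.

Definition has_prime_height (P : prime_idealr R) (h : nat) : Prop :=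
  prime_chain P h /\ forall m, prime_chain P m -> (m <= h)%N.

Definition prime_over (I : R -> Prop) (P : prime_idealr R) : Prop :=
  forall f, I f -> f \in P.

(* Relational, because the height may be infinite: no h qualifies for the unit
   ideal, which lies in no prime.  Primes of infinite height do not affect the
   minimum. *)
Definition has_height (I : R -> Prop) (h : nat) : Prop :=
  (exists2 P, prime_over I P & has_prime_height P h)
  /\ forall P h', prime_over I P -> has_prime_height P h' -> (h <= h')%N.

End Height.

Record clutter (n : nat) := Clutter {
  edges :> {set {set 'I_n}};
  edges_antichain : {in edges &, forall e e' : {set 'I_n}, e \subset e' -> e = e'}
}.

Section Clutters.
Variables (n : nat) (C : clutter n).
Implicit Types (A e : {set 'I_n}) (M : {set {set 'I_n}}) (x : 'I_n).

Definition isolated x : bool := [forall e in edges C, x \notin e].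

Definition vertex_cover A : bool := [forall e in edges C, A :&: e != set0].

Definition unmixed : Prop :=
  forall A B, minset vertex_cover A -> minset vertex_cover B -> #|A| = #|B|.

Definition disjoint_edges M : bool := (M \subset edges C) && trivIset M.

Definition matching_number : nat := \max_(M | disjoint_edges M) #|M|.

Variable K : fieldType.

Definition edge_monomial e : {mpoly K[n]} := \prod_(i in e) 'X_i.

Definition edge_ideal (f : {mpoly K[n]}) : Prop :=
  exists a : {set 'I_n} -> {mpoly K[n]},
    f = \sum_(e in edges C) a e * edge_monomial e.

Definition konig_property : Prop := has_height edge_ideal matching_number.

Definition konig_perfect_matching M : Prop :=
  [/\ disjoint_edges M, cover M = [set: 'I_n] & has_height edge_ideal #|M|].

End Clutters.

(* Main.v *)
Require Import Defs.
From mathcomp Require Import all_boot all_order all_algebra.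
From HB Require Import structures.
From mathcomp.multinomials Require Import mpoly.

(** The bridge between algebra and combinatorics is that an edge ideal of height
    [h] forces a vertex cover with at most [h] elements.  If a prime [P] contains
    the ideal, it contains a variable of every edge, so the set [A] of the
    variables lying in [P] is a vertex cover; and the primes generated by the
    initial segments of [A], with [P] on top, form a chain of length [#|A|]
    ending at [P], so [#|A|] is at most the height of [P].  These primes are
    kernels of the substitutions that send some of the variables to [0], and only
    this lower bound on heights is used, so no dimension theory is involved.
    Since pairwise disjoint edges need distinct elements in a cover, the König
    property then gives a matching [M] and a vertex cover of the same size.

    If the clutter is unmixed, every minimal vertex cover thus has [#|M|]
    elements, so it meets every edge of [M] exactly once and has no element
    outside the edges of [M].  A set [S] containing no edge has a vertex cover
    as complement, and a minimal one inside it avoids [S].  With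
    [S = e :\ x], such a cover contains [x], as it must meet the edge [e]; hence
    [M] covers all vertices.  With [S = (e :\ x) :|: (e' :\ y)], it contains both
    [x] and [y], which is impossible if these lie in a common edge of [M].

    Conversely, if a minimal vertex cover [A] contains distinct [x], [y] of the
    same edge of [M], then minimality gives edges [e], [e'] meeting [A] only in
    [x] and only in [y], and an edge inside [(e :\ x) :|: (e' :\ y)] would miss
    [A].  So [A] meets every edge of the perfect matching [M] exactly once, and
    [#|A| = #|M|]. *)

Set Implicit Arguments.
Unset Strict Implicit.
Unset Printing Implicit Defensive.

Import GRing.Theory.
Local Open Scope ring_scope.

(** * Primes generated by variables *)

Section VariablePrimes.
Variables (K : fieldType) (n : nat).
Implicit Types (B : {set 'I_n}) (P : prime_idealr {mpoly K[n]}).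

Definition kill_vars B : {rmorphism {mpoly K[n]} -> {mpoly K[n]}} :=
  comp_mpoly [tuple if i \in B then 0 else 'X_i | i < n].

Lemma kill_varsX B i : kill_vars B 'X_i = if i \in B then 0 else 'X_i.
Proof. by rewrite /kill_vars /= comp_mpolyXU -tnth_nth tnth_mktuple. Qed.

(** The ideal generated by the variables in [B], as a kernel: this makes it
    decidable, and prime because polynomials form an integral domain. *)
Definition var_ideal B : {pred {mpoly K[n]}} := fun f => kill_vars B f == 0.

Lemma var_idealP B f : (f \in var_ideal B) = (kill_vars B f == 0).
Proof. by []. Qed.

Fact var_ideal_closed B : idealr_closed (var_ideal B).
Proof.
split=> [||a u v]; rewrite !var_idealP ?rmorph0 ?rmorph1 ?oner_eq0 //.
by move=> /eqP u0 /eqP v0; rewrite rmorphD rmorphM u0 v0 mulr0 addr0.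
Qed.

Fact var_ideal_prime B : prime_idealr_closed (var_ideal B).
Proof. by move=> u v; rewrite !var_idealP rmorphM mulf_eq0. Qed.

HB.instance Definition _ B := isIdealr.Build _ (var_ideal B) (var_ideal_closed B).
HB.instance Definition _ B :=
  isPrimeIdealrClosed.Build _ (var_ideal B) (@var_ideal_prime B).

Definition var_prime B : prime_idealr {mpoly K[n]} := var_ideal B.

Lemma mem_var_prime B i : ('X_i \in var_prime B) = (i \in B).
Proof.
rewrite [LHS]var_idealP kill_varsX; case: (i \in B); rewrite ?eqxx //.
apply/negbTE/eqP => /(congr1 (fun p : {mpoly K[n]} => p@_U_(i))).
by rewrite mcoeffX eqxx mcoeff0 => /eqP; rewrite oner_eq0.
Qed.

(** The substitution and the identity are ring morphisms that agree modulo [P]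
    on constants and on variables, hence on all monomials and their sums. *)
Lemma kill_vars_congr P B f :
  (forall i, i \in B -> 'X_i \in P) -> f - kill_vars B f \in P.
Proof.
move=> BP.
have congrM a b a' b' : a - a' \in P -> b - b' \in P -> a * b - a' * b' \in P.
  move=> Pa Pb; have -> : a * b - a' * b' = a * (b - b') + b' * (a - a').
    by rewrite !mulrBr [b' * a]mulrC [b' * a']mulrC addrA subrK.
  by rewrite rpredD // idealMr.
rewrite {2}(mpolyE f) {1}(mpolyE f) (rmorph_sum (kill_vars B)).
rewrite -sumrB rpred_sum // => m _.
rewrite -!mul_mpolyC rmorphM; apply: (congrM).
  by rewrite /kill_vars /= comp_mpolyC subrr rpred0.
rewrite mpolyXE_id rmorph_prod.
apply: (big_ind2 (fun a b => a - b \in P)) => [|a a' b b'|i _].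
- by rewrite subrr rpred0.
- exact: congrM.
rewrite rmorphXn /=; elim: (m i) => [|k IHk]; first by rewrite !expr0 subrr rpred0.
rewrite !exprS; apply: (congrM) => //; rewrite kill_varsX.
by case: ifP => [/BP|_]; rewrite ?subr0 ?subrr ?rpred0.
Qed.

Lemma var_prime_sub P B :
  (forall i, i \in B -> 'X_i \in P) -> {subset var_prime B <= P}.
Proof.
move=> BP f /eqP f0.
by have := kill_vars_congr f BP; rewrite f0 subr0.
Qed.

(** Adjoining the variables of [P] one at a time gives strict inclusions, as each
    prime is told apart from the previous one by the new variable; the last
    prime, generated by all of them, may be smaller than [P] and is replaced by
    [P]. *)
Lemma prime_chain_vars P : prime_chain P #|[set i | 'X_i \in P]|.
Proof.
set A := [set i | 'X_i \in P].
pose B k := [set i in take k (enum A)].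
have BP k i : i \in B k -> 'X_i \in P.
  by rewrite inE => /mem_take; rewrite mem_enum inE.
exists (fun k => if (k < #|A|)%N then var_prime (B k) else P).
split=> [k kA|]; last by rewrite ltnn.
have szA : (k < size (enum A))%N by rewrite -cardE.
have [x0 _] : {x0 : 'I_n | x0 \in A}.
  by apply/sigW/set0Pn; rewrite -card_gt0; apply: leq_ltn_trans kA.
pose x := nth x0 (enum A) k.
have Bk1 : B k.+1 = x |: B k.
  by apply/setP=> i; rewrite !inE (take_nth x0) // mem_rcons inE.
have xBk : x \notin B k.
  have := enum_uniq (mem A); rewrite -(cat_take_drop k.+1 (enum A)).
  rewrite (take_nth x0) // cat_uniq rcons_uniq inE.
  by case/andP=> /andP[].
have next i : i \in B k.+1 ->
    'X_i \in (if (k.+1 < #|A|)%N then var_prime (B k.+1) else P).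
  by case: ifP => _ iB; [rewrite mem_var_prime | apply: BP iB].
rewrite kA; split=> [|/(_ 'X_x)].
  by apply: var_prime_sub => i iB; apply: next; rewrite Bk1 setU1r.
rewrite mem_var_prime => xP; case/negP: xBk.
by apply: xP; apply: next; rewrite Bk1 setU11.
Qed.

End VariablePrimes.

(** * From height to vertex covers *)

Lemma has_height_unique (R : comNzRingType) (I : R -> Prop) h h' :
  has_height I h -> has_height I h' -> h = h'.
Proof.
move=> [[P IP Ph] minh] [[P' IP' Ph'] minh'].
by apply/eqP; rewrite eqn_leq (minh P' h') // (minh' P h).
Qed.

Section Covers.
Variables (n : nat) (C : clutter n).
Implicit Types (A e S : {set 'I_n}) (M : {set {set 'I_n}}).

Lemma edge_ideal_edge (K : fieldType) e :
  e \in edges C -> edge_ideal C (edge_monomial K e).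
Proof.
move=> eC; exists (fun e' => (e' == e)%:R).
rewrite (bigD1 e) //= eqxx mul1r big1 ?addr0 // => e' /andP[_ /negbTE ->].
by rewrite mul0r.
Qed.

Lemma prime_over_cover (K : fieldType) (P : prime_idealr {mpoly K[n]}) :
  prime_over (@edge_ideal n C K) P -> vertex_cover C [set i | 'X_i \in P].
Proof.
move=> IP; apply/forall_inP => e eC.
have: edge_monomial K e \in P by apply: IP; apply: edge_ideal_edge.
have [/eqP eq0 | //] := boolP (_ == set0); rewrite /edge_monomial => Pe.
suff: \prod_(i in e) 'X_i \notin P by rewrite Pe.
apply: (big_ind (fun f => f \notin P)) => [|f g fP gP|i ie].
- by rewrite idealr1.
- by rewrite prime_idealrM negb_or fP.
by apply/negP => Pi; move/setP/(_ i): eq0; rewrite !inE Pi ie.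
Qed.

Lemma height_cover (K : fieldType) h :
  has_height (@edge_ideal n C K) h -> exists2 A, vertex_cover C A & (#|A| <= h)%N.
Proof.
move=> [[P IP [_ maxh]] _]; exists [set i | 'X_i \in P].
  exact: prime_over_cover.
exact/maxh/prime_chain_vars.
Qed.

(** * Covers and disjoint edges *)

Lemma sum_card_setI_trivIset M A :
  trivIset M -> (\sum_(e in M) #|A :&: e| = #|A :&: cover M|)%N.
Proof.
move=> tM; rewrite -sum1_card.
under [RHS]eq_bigl => i do rewrite inE andbC.
rewrite big_trivIset_cond //=.
by apply: eq_bigr => e _; rewrite -sum1_card; apply: eq_bigl => i; rewrite inE andbC.
Qed.

Lemma card_matching_leqif M A : disjoint_edges C M -> vertex_cover C A ->
  (#|M| <= #|A :&: cover M| ?= iff [forall e in M, #|A :&: e| == 1%N])%N.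
Proof.
move=> /andP[/subsetP MC tM] /forall_inP cA.
rewrite -sum_card_setI_trivIset // -sum1_card; apply: leqif_sum => e eM.
split; last by rewrite eq_sym.
by rewrite card_gt0 cA // MC.
Qed.

Lemma card_matching_cover M A :
  disjoint_edges C M -> vertex_cover C A -> (#|M| <= #|A|)%N.
Proof.
move=> dM cA; apply: leq_trans (card_matching_leqif dM cA) _.
exact/subset_leq_card/subsetIl.
Qed.

(** All of [#|M| <= #|A :&: cover M| <= #|A|] are equal, and the first
    equality forces every term [#|A :&: e|] to be [1]. *)
Lemma tight_coverP M A : disjoint_edges C M -> vertex_cover C A -> #|A| = #|M| ->
  A \subset cover M /\ forall e, e \in M -> #|A :&: e| = 1%N.
Proof.
move=> dM cA cardA; have eqif := card_matching_leqif dM cA.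
have AI : A :&: cover M = A.
  by apply/eqP; rewrite eqEcard subsetIl cardA (leq_of_leqif eqif).
split=> [|e eM]; first by rewrite -AI subsetIr.
apply/eqP; move: e eM; apply/forall_inP.
by rewrite -(eq_leqif eqif) AI cardA.
Qed.

Lemma max_matching : exists2 M, disjoint_edges C M & #|M| = matching_number C.
Proof.
have [|M dM maxM] := @eq_bigmax_cond _ (disjoint_edges C) (fun M => #|M|).
  apply/card_gt0P; exists set0; rewrite unfold_in /disjoint_edges sub0set.
  by apply/trivIsetP => e; rewrite inE.
by exists M.
Qed.

Lemma min_cover_avoiding S : (forall f, f \in edges C -> ~~ (f \subset S)) ->
  exists2 A, minset (vertex_cover C) A & forall x, x \in A -> x \notin S.
Proof.
move=> noS; have cS : vertex_cover C (~: S).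
  by apply/forall_inP => f fC; rewrite setIC -setDE setD_eq0 noS.
have [A minA /subsetP AS] := minset_exists cS.
by exists A => // x /AS; rewrite inE.
Qed.

Lemma cover_meets A e x : vertex_cover C A -> e \in edges C ->
  (forall z, z \in A -> z \notin e :\ x) -> x \in A.
Proof.
move=> /forall_inP cA eC avoid; have /set0Pn[z] := cA e eC.
rewrite inE => /andP[zA ze]; have := avoid z zA.
by rewrite !inE ze andbT negbK => /eqP <-.
Qed.

Lemma min_cover_through x : ~~ isolated C x ->
  exists2 A, minset (vertex_cover C) A & x \in A.
Proof.
rewrite negb_forall_in => /exists_inP[e eC]; rewrite negbK => xe.
(* no edge lies in the proper subset [e :\ x] of the edge [e] *)
have [|A minA avoid] := @min_cover_avoiding (e :\ x).
  move=> f fC; apply/negP => fe.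
  have fE : f = e.
    by apply: (edges_antichain fC eC); apply: subset_trans fe (subD1set e x).
  by move/subsetP: fe => /(_ x); rewrite fE xe !inE eqxx => /(_ isT).
by exists A => //; apply: cover_meets (minsetp minA) eC avoid.
Qed.

Lemma min_cover_private A x : minset (vertex_cover C) A -> x \in A ->
  exists2 e, e \in edges C & A :&: e = [set x].
Proof.
move=> minA xA; have /forall_inP cA := minsetp minA.
have: ~~ vertex_cover C (A :\ x).
  apply/negP => cAx; have := minsetinf minA cAx (subD1set _ _).
  by move/setP/(_ x); rewrite !inE eqxx xA.
rewrite negb_forall_in => /exists_inP[e eC]; rewrite negbK => /eqP Axe.
exists e => //; have /set0Pn[z zAe] := cA e eC.
have only w : w \in A :&: e -> w = x.
  rewrite inE => /andP[wA we]; apply/eqP; have /setP/(_ w) := Axe.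
  by rewrite !inE wA we !andbT => /negbFE.
apply/setP=> w; rewrite in_set1; apply/idP/eqP => [/only //|->].
by rewrite -(only z zAe).
Qed.

Lemma unmixed_card_min_cover (K : fieldType) A : konig_property C K -> unmixed C ->
  minset (vertex_cover C) A -> #|A| = matching_number C.
Proof.
move=> hK unmC minA; have [B cB Ble] := height_cover hK.
have [B' minB' /subset_leq_card B'B] := minset_exists cB.
have [M dM cardM] := max_matching.
apply/eqP; rewrite eqn_leq -{2}cardM card_matching_cover ?(minsetp minA) // andbT.
by rewrite (unmC A B' minA minB') (leq_trans B'B).
Qed.

End Covers.

Theorem corollary2p11 (K : fieldType) (n : nat) (C : clutter n)
    (hkonig : konig_property C K)
    (hisol : forall x : 'I_n, ~~ isolated C x) :
  unmixed C <->
  exists M : {set {set 'I_n}},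
    konig_perfect_matching C K M /\
    forall e e' : {set 'I_n}, e \in edges C -> e' \in edges C -> e <> e' ->
    forall x y : 'I_n, x <> y -> x \in e -> y \in e' ->
    (exists2 ei, ei \in M & (x \in ei) && (y \in ei)) ->
    exists2 f : {set 'I_n}, f \in edges C & f \subset (e :\ x) :|: (e' :\ y).
Proof.
split=> [unmC | [M [[dM covM _] exch]]].
  have [M dM cardM] := max_matching C; exists M.
  have tight A : minset (vertex_cover C) A ->
      A \subset cover M /\ forall e, e \in M -> #|A :&: e| = 1%N.
    move=> minA; apply: (tight_coverP dM (minsetp minA)).
    by rewrite cardM; apply: unmixed_card_min_cover hkonig unmC minA.
  split.
    split=> //; last by rewrite cardM.
    apply/eqP; rewrite -subTset; apply/subsetP => x _.
    have [A /tight[/subsetP AM _] xA] := min_cover_through (hisol x).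
    exact: AM.
  move=> e e' eC e'C _ x y xy _ _ [ei eiM /andP[xei yei]].
  set S := _ :|: _.
  have [/exists_inP //|] := boolP [exists f in edges C, f \subset S].
  rewrite negb_exists_in => /forall_inP noS.
  have [A minA avoid] := min_cover_avoiding noS.
  have cA := minsetp minA.
  have xA : x \in A.
    by apply: cover_meets cA eC _ => z /avoid; rewrite inE negb_or => /andP[].
  have yA : y \in A.
    by apply: cover_meets cA e'C _ => z /avoid; rewrite inE negb_or => /andP[].
  have [_ /(_ ei eiM)/eqP/cards1P[z /setP Aei]] := tight A minA.
  case: xy; have := Aei x; have := Aei y; rewrite !inE xA yA xei yei.
  by move=> /esym/eqP-> /esym/eqP->.
suff card_min A : minset (vertex_cover C) A -> #|A| = #|M|.
  by move=> A B /card_min-> /card_min->.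
move=> minA; have cA := minsetp minA.
have eqif := card_matching_leqif dM cA; rewrite covM setIT in eqif.
apply/esym/eqP; rewrite (eq_leqif eqif); apply/forall_inP => ei eiM.
have [MC _] := andP dM; have eiC := subsetP MC ei eiM.
have /set0Pn[x xAei] := forall_inP cA ei eiC.
apply/cards1P; exists x; apply/setP => y; rewrite in_set1.
apply/idP/eqP => [yAei|->//]; apply/eqP; apply: contraT => yx.
move: xAei yAei; rewrite !inE => /andP[xA xei] /andP[yA yei].
have [e eC Ae] := min_cover_private minA xA.
have [e' e'C Ae'] := min_cover_private minA yA.
have /setIP[_ xe] : x \in A :&: e by rewrite Ae set11.
have /setIP[_ ye'] : y \in A :&: e' by rewrite Ae' set11.
have ee' : e <> e'.
  by move=> eE; move: yx; rewrite -in_set1 -Ae eE Ae' set11.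
have xy : x <> y by apply/eqP; rewrite eq_sym.
have [|f fC /subsetP fS] := exch e e' eC e'C ee' x y xy xe ye'.
  by exists ei => //; rewrite xei.
(* the edge [f] would have to avoid the cover [A] *)
have /set0Pn[z /setIP[zA /fS]] := forall_inP cA f fC.
rewrite !inE => /orP[] /andP[/eqP zx ze].
  by case: zx; apply/set1P; rewrite -Ae inE zA.
by case: zx; apply/set1P; rewrite -Ae' inE zA.
Qed.
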